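(* Let $f:X\to Y$ be a map (not assumed continuous) from a perfectly paracompact hereditarily Baire space $X$ to a regular space $Y$. Then the following conditions are equivalent: (1) $f$ is scatteredly continuous; (2) $f$ is weakly discontinuous; (3) $f$ is piecewise continuous. If, moreover, $X$ is a Preiss-Simon space, then (1)--(3) are equivalent to each of the conditions: (4) $f$ is $G_\delta$-measurable; (5) $f$ is weakly $G_\delta$-measurable. If $Y$ is path-connected and belongs to the class $\sigma\mathrm{AE}(X)$, then (1)--(3) are equivalent to (6) $f$ is of the stable first Baire class.
   Context: Conventions: regular spaces are $T_1$, paracompact spaces are Hausdorff (as in Engelking's book). For a map $g$ between topological spaces, $D(g)$ is the set of points of its domain at which $g$ is not continuous. Spaces. $X$ is perfectly paracompact if it is paracompact and each closed subset of $X$ is of type $G_\delta$ in $X$. $X$ is hereditarily Baire if each closed subspace $F\subset X$ is Baire (the intersection of any sequence of open dense subsets of $F$ is dense in $F$). $X$ is a Preiss-Simon space if for every $x\in X$ and every $A\subset X$ with $x\in\overline{A}$ there is a sequence $(U_n)_{n\in\omega}$ of non-empty (relatively) open subsets of $A$ that converges to $x$, i.e. each neighborhood of $x$ contains all but finitely many sets $U_n$. For spaces $B\subset Y$ write $(Y,B)\in AE(X)$ if each continuous map $A\to B$ defined on a closed subspace $A\subset X$ has a continuous extension $X\to Y$. $Y\in\sigma\mathrm{AE}(X)$ means that $Y$ has a countable cover $\{Y_n:n\in\omega\}$ by closed $G_\delta$-subsets of $Y$ such that $(Y,Y_n)\in AE(X)$ for all $n\in\omega$. Maps. $f:X\to Y$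 is - scatteredly continuous if for each non-empty subspace $A\subset X$ the restriction $f|A:A\to Y$ has a point of continuity; - weakly discontinuous if for every subspace $A\subset X$ the set $D(f|A)$ is nowhere dense in $A$; - piecewise continuous if $X$ has a countable closed cover $\mathcal C$ such that $f|C$ is continuous for every $C\in\mathcal C$; - $G_\delta$-measurable if $f^{-1}(U)$ is of type $G_\delta$ in $X$ for every open $U\subset Y$; - weakly $G_\delta$-measurable if there is a regular countably additive base $\mathcal B$ of the topology of $Y$ such that $f^{-1}(U)$ is of type $G_\delta$ in $X$ for every $U\in\mathcal B$; here a base $\mathcal B$ is regular if for each open $U\subset Y$ and $y\in U$ there are $V,W\in\mathcal B$ with $y\in V\subset Y\setminus W\subset U$, and countably additive if the union of any countable subfamily of $\mathcal B$ belongs to $\mathcal B$; - of the stable first Baire class if there is a sequence $(f_n:X\to Y)_{n\in\omega}$ of continuous maps such that for every $x\in X$ there is $n\in\omega$ with $f_m(x)=f(x)$ for all $m\ge n$. *)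

(* Defs.v *)
From mathcomp Require Import all_boot all_order all_algebra.
From mathcomp Require Import all_classical all_reals topology normedtype.
From mathcomp Require Import borel_hierarchy.

Set Implicit Arguments.
Unset Strict Implicit.
Unset Printing Implicit Defensive.

Import numFieldNormedType.Exports.
Local Open Scope classical_set_scope.
Local Open Scope ring_scope.

(* A subspace A of T is the type [set_type A] (often inserted by coercion), with the
   topology induced by [set_val : A -> T]. *)

Definition nowhere_dense (T : topologicalType) (S : set T) :=
  (closure S)° = set0.

Definition baire_space (T : topologicalType) :=
  forall U : nat -> set T, (forall n, open (U n) /\ dense (U n)) ->
    dense (\bigcap_n U n).

Definition hereditarily_baire (X : topologicalType) :=
  forall F : set X, closed F -> baire_space (set_type F).

Definition open_cover (X : topologicalType) (U : set (set X)) :=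
  U `<=` open /\ cover U id = [set: X].

Definition locally_finite (X : topologicalType) (V : set (set X)) :=
  forall x : X, exists2 N, nbhs x N & finite_set [set A | V A /\ A `&` N !=set0].

Definition paracompact (X : topologicalType) :=
  hausdorff_space X /\
  forall U : set (set X), open_cover U -> exists V : set (set X),
    [/\ open_cover V, locally_finite V
      & forall A, V A -> exists2 B, U B & A `<=` B].

Definition perfectly_paracompact (X : topologicalType) :=
  paracompact X /\ forall F : set X, closed F -> Gdelta F.

(* [regular_space] does not include the T1 axiom. *)
Definition regular_T1_space (Y : topologicalType) :=
  regular_space Y /\ accessible_space Y.

Definition preiss_simon (X : topologicalType) :=
  forall (x : X) (A : set X), closure A x -> exists U : nat -> set X,
    (forall n, U n !=set0 /\ exists2 O, open O & U n = O `&` A) /\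
    (forall N, nbhs x N -> \forall n \near \oo, U n `<=` N).

Definition absolute_extensor_pair (X Y : topologicalType) (B : set Y) :=
  forall (A : set X) (g : A -> B), closed A -> continuous g ->
    exists2 G : X -> Y, continuous G & forall a : A, G (set_val a) = set_val (g a).

Definition sigma_absolute_extensor (X Y : topologicalType) :=
  exists Y_ : nat -> set Y, \bigcup_n Y_ n = [set: Y] /\
    forall n, [/\ closed (Y_ n), Gdelta (Y_ n) & absolute_extensor_pair X (Y_ n)].

Definition path_connected (R : realType) (Y : topologicalType) :=
  forall y z : Y, exists g : R -> Y,
    [/\ {within `[0, 1]%classic, continuous g}, g 0 = y & g 1 = z].

Section maps.
Context {X Y : topologicalType}.
Implicit Type f : X -> Y.

Definition scatteredly_continuous f :=
  forall A : set X, A !=set0 ->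
    exists a : A, {for a, continuous (f \o set_val : A -> Y)}.

Definition weakly_discontinuous f :=
  forall A : set X,
    nowhere_dense [set a : A | ~ {for a, continuous (f \o set_val : A -> Y)}].

Definition piecewise_continuous f :=
  exists C : set (set X), [/\ countable C, cover C id = [set: X]
    & forall F, C F -> closed F /\ {within F, continuous f}].

Definition Gdelta_measurable_map f :=
  forall U : set Y, open U -> Gdelta (f @^-1` U).

Definition regular_base (B : set (set Y)) :=
  basis B /\ forall (U : set Y) (y : Y), open U -> U y ->
    exists V W, [/\ B V, B W, V y, V `<=` ~` W & ~` W `<=` U].

Definition countably_additive (B : set (set Y)) :=
  forall D : set (set Y), countable D -> D `<=` B -> B (\bigcup_(V in D) V).

Definition weakly_Gdelta_measurable f :=
  exists B : set (set Y), [/\ regular_base B, countably_additive B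
    & forall U, B U -> Gdelta (f @^-1` U)].

Definition stable_first_Baire f :=
  exists f_ : nat -> X -> Y, (forall n, continuous (f_ n)) /\
    forall x, exists n, forall m, (n <= m)%N -> f_ m x = f x.

End maps.

(* Main.v *)
Require Import Defs.
From mathcomp Require Import all_boot all_order all_algebra.
From mathcomp Require Import all_classical all_reals topology normedtype.
From mathcomp Require Import borel_hierarchy.

(** (1) => (2): at a continuity point of the restriction to a relatively dense set of
    discontinuities, regularity of [Y] contradicts the discontinuity.
    (2) => (3): the union of all open sets on which [f] is piecewise continuous is again
    such a set, because it is F_sigma and continuity on closed pieces passes to locally
    finite unions; weak discontinuity on its complement shows that it is everything.
    (3) => (1) is the Baire category theorem on closures.
    (5) => (1): call a set bad if [f] is not scatteredly continuous on it. By Baire, if [V]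
    and [W] are disjoint base sets and [T] is bad, then [T \ f^-1 V] or [T \ f^-1 W] is
    bad. If [X] is bad, this allows one to choose points [x_n] whose values have pairwise
    disjoint neighborhoods [V_n] in the base, every [x_i] being a limit of points [x_n] of
    either of two colours. The unions of the [V_n] of each colour then have disjoint
    G_delta preimages, both dense in the closure of [{x_n}]: a contradiction.
    (3) => (6): at stage [m], [f] is to be extended from finitely many disjoint closed pieces.
    The extension of one piece can be made constant off a small neighborhood with a
    prescribed constant, so the extensions can be glued. *)

Set Implicit Arguments.
Unset Strict Implicit.
Unset Printing Implicit Defensive.

Import Order.TTheory GRing.Theory Num.Theory.
Import numFieldNormedType.Exports.
Local Open Scope classical_set_scope.

(** * Continuity relative to a subset *)

Section Continuity.
Context {X Y : topologicalType}.
Implicit Types (f : X -> Y) (A B : set X).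

(** Continuity of the restriction of [f] to [A], phrased with ambient open sets so that [A] can vary
    without a change of type. *)
Definition cts_at A f a := forall U, open U -> U (f a) ->
  exists O, [/\ open O, O a & forall z, O z -> A z -> U (f z)].

Lemma cts_at_nbhs A f a (U : set Y) : cts_at A f a -> nbhs (f a) U ->
  nbhs a [set z | A z -> U (f z)].
Proof.
move=> ca; rewrite !nbhsE => -[U' [oU' U'a] U'U].
have [O [oO Oa OU]] := ca U' oU' U'a.
by exists O => // z Oz Az; apply: U'U; exact: OU.
Qed.

Lemma cts_at_sub A B f a : A `<=` B -> cts_at B f a -> cts_at A f a.
Proof.
move=> AB cB U oU Ua; have [O [oO Oa OU]] := cB U oU Ua.
by exists O; split=> // z Oz /AB; exact: OU.
Qed.

Lemma cts_at_open A B f a (O : set X) : open O -> O a -> O `&` A `<=` B ->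
  cts_at B f a -> cts_at A f a.
Proof.
move=> oO Oa OAB cB U oU Ua; have [O' [oO' O'a OU]] := cB U oU Ua.
exists (O `&` O'); split=> //; first exact: openI.
by move=> z [Oz O'z] Az; apply: OU => //; exact: OAB.
Qed.

Lemma cts_at_withinP A f a :
  cts_at A f a <-> f x @[x --> within A (nbhs a)] --> f a.
Proof.
split=> [ca U nU|ca U oU Ua].
  exact: (cts_at_nbhs ca nU).
have : nbhs a [set z | A z -> U (f z)] := ca U (open_nbhs_nbhs (conj oU Ua)).
by rewrite nbhsE => -[O [oO Oa] OU]; exists O; split.
Qed.

Lemma continuous_withinP A f :
  {within A, continuous f} <-> forall a, A a -> cts_at A f a.
Proof.
split=> [/subspace_continuousP cf a Aa|cf]; first exact/cts_at_withinP/cf.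
by apply/subspace_continuousP => a Aa; exact/cts_at_withinP/cf.
Qed.

Lemma continuous_cts_at f : continuous f <-> forall a, cts_at setT f a.
Proof.
split=> cf.
  move=> a U oU Ua; exists (f @^-1` U); split=> //.
  by apply: open_comp => // x _; exact: cf.
move=> a U nU; have := cts_at_nbhs (cf a) nU.
by apply: filterS => z; exact.
Qed.

Lemma restr_cts_atP A f (a : A) :
  {for a, continuous (f \o set_val : A -> Y)} <-> cts_at A f (set_val a).
Proof.
split=> [ca U oU Ua|ca U /= nU].
  have /= := ca U (open_nbhs_nbhs (conj oU Ua)).
  rewrite nbhs_simpl /= => -[_ [/= [O oO <-] /= Oa OU]].
  exists O; split=> // z Oz Az.
  by have := OU (exist _ z (mem_set Az)); rewrite !set_valE /=; exact.
rewrite nbhs_simpl /=.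
have := cts_at_nbhs ca nU; rewrite nbhsE => -[O [oO Oa] OU].
exists (set_val @^-1` O); split=> //=; first by exists O.
by move=> z /= /OU; apply; exact: set_valP.
Qed.

Lemma scatteredP f : scatteredly_continuous f <->
  forall A, A !=set0 -> exists2 a, A a & cts_at A f a.
Proof.
split=> sc A A0; have [a ca] := sc A A0.
  by exists (set_val a); [exact: set_valP|exact/restr_cts_atP].
by move=> cf; exists (exist _ a (mem_set ca)); exact/restr_cts_atP.
Qed.

(** The complement of the closure of the discontinuity set is relatively open and consists of
    continuity points; nowhere density says that it meets every nonempty relatively open set. *)
Lemma weakly_discontinuousP f : weakly_discontinuous f <->
  forall A O, open O -> O `&` A !=set0 -> exists O',
   [/\ open O', O' `<=` O, O' `&` A !=set0
     & forall a, (O' `&` A) a -> cts_at A f a].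
Proof.
split=> wd A.
  move=> O oO [a0 [Oa0 Aa0]].
  have := wd A; rewrite /nowhere_dense; set D := [set a : A | _] => nd.
  have [b [Ob nDb]] : exists b : A, O (set_val b) /\ ~ closure D b.
    apply: contrapT => h.
    have : (closure D)° (exist _ a0 (mem_set Aa0)).
      exists (set_val @^-1` O); split=> //=; first by exists O.
      by move=> b /= Ob; apply: contrapT => nb; apply: h; exists b.
    by rewrite nd.
  have : (~` closure D)° b.
    by apply: open_nbhs_nbhs; split=> //; exact: closed_openC (@closed_closure _ D).
  case=> _ [/= [O1 oO1 <-] /= O1b O1D].
  exists (O `&` O1); split=> //; first exact: openI.
    by exists (set_val b); split=> //; exact: set_valP.
  move=> a [[Oa O1a] Aa].
  have := O1D (exist _ a (mem_set Aa)) O1a => nDa.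
  have : ~ D (exist _ a (mem_set Aa)) by move=> Da; exact/nDa/subset_closure.
  by move=> /contrapT/restr_cts_atP.
rewrite /nowhere_dense -subset0 => a [_ [/= [O oO <-] /= Oa OD]].
have [|O' [oO' O'O [b [O'b Ab]] O'c]] := wd A O oO.
  by exists (set_val a); split=> //; exact: set_valP.
have /= Db := OD (exist _ b (mem_set Ab)) (O'O _ O'b).
have [] := Db (set_val @^-1` O').
  by apply: open_nbhs_nbhs; split=> //; exists O'.
move=> c [/= nc O'c']; apply: nc; apply/restr_cts_atP; apply: O'c.
by split=> //; exact: set_valP.
Qed.

End Continuity.

(** * Shrinking in regular spaces; G_delta and F_sigma sets *)

Lemma regular_shrink (T : topologicalType) (U : set T) y :
  regular_space T -> open U -> U y ->
  exists V, [/\ open V, V y & closure V `<=` U].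
Proof.
move=> rT oU Uy; have [V] := rT y U (open_nbhs_nbhs (conj oU Uy)).
rewrite nbhsE => -[V' [oV' V'y] V'V] VU; exists V'; split=> //.
by apply: subset_trans VU; exact: closure_subset.
Qed.

Lemma open_meet_closure (T : topologicalType) (O A : set T) :
  open O -> O `&` closure A !=set0 -> O `&` A !=set0.
Proof.
move=> oO [x [Ox cAx]].
by have [z [Az Oz]] := cAx O (open_nbhs_nbhs (conj oO Ox)); exists z.
Qed.

Lemma Gdelta_setC (T : topologicalType) (G : set T) : Gdelta G ->
  exists2 C : nat -> set T, (forall n, closed (C n)) & ~` G = \bigcup_n C n.
Proof.
case=> O oO ->; exists (fun n => ~` O n).
  by move=> n; exact: open_closedC.
by rewrite setC_bigcap.
Qed.

Lemma setC_Gdelta (T : topologicalType) (C : nat -> set T) :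
  (forall n, closed (C n)) -> Gdelta (~` \bigcup_n C n).
Proof.
move=> cC; exists (fun n => ~` C n).
  by move=> n; exact: closed_openC.
by rewrite setC_bigcup.
Qed.

(** * Baire category *)

Section HereditarilyBaire.
Context {X : topologicalType} (bX : hereditarily_baire X).
Implicit Types A : set X.

(** If no [C n] had interior in [closure A], the Baire property of this closed subspace would give a
    point outside all of them. The open set found meets [A] because [A] is dense in its closure. *)
Lemma baire_closed_cover A (C : nat -> set X) : A !=set0 ->
  (forall n, closed (C n)) -> closure A `<=` \bigcup_n C n ->
  exists n, exists O, [/\ open O, O `&` A !=set0 & O `&` closure A `<=` C n].
Proof.
move=> [a Aa] cC AC; apply: contrapT => h.
have dC n : open (set_val @^-1` (~` C n) : set (closure A)) /\
    dense (set_val @^-1` (~` C n) : set (closure A)).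
  split; first by exists (~` C n) => //; exact: closed_openC.
  move=> O' [b Ob] oO'; case: oO' Ob => O oO <- /= Ob.
  apply: contrapT => nOC; apply: h; exists n, O; split=> //.
    apply: open_meet_closure => //; exists (set_val b).
    by split=> //; exact: set_valP.
  move=> z [Oz cz]; apply: contrapT => nCz; apply: nOC.
  by exists (exist _ z (mem_set cz)).
have [||x [_ Cx]] := bX (@closed_closure _ A) dC (O := setT).
- by exists (exist _ a (mem_set (subset_closure Aa))).
- exact: openT.
have [n _ Cn] := AC (set_val x) (set_valP x).
exact: (Cx n).
Qed.

(** The complements of [G] and [H] are F_sigma and cover the space, so one of their closed pieces
    contains a nonempty relatively open part of [closure A]. *)
Lemma disjoint_Gdelta A (G H : set X) : Gdelta G -> Gdelta H ->
  G `&` H = set0 -> A !=set0 ->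
  exists O, [/\ open O, O `&` A !=set0
    & O `&` A `<=` ~` G \/ O `&` A `<=` ~` H].
Proof.
move=> /Gdelta_setC[C cC GC] /Gdelta_setC[D cD HD] GH A0.
(* Odd indices list the pieces of the complement of [G], even indices those of [H]. *)
pose E n := if odd n then C n./2 else D n./2.
have [||n [O [oO OA OE]]] := @baire_closed_cover A E A0.
- by move=> n; rewrite /E; case: ifP.
- move=> x _; have [Gx|nGx] := pselect (G x).
    have : (~` H) x by move=> Hx; have : set0 x by rewrite -GH.
    by rewrite HD => -[n _ Dn]; exists n.*2 => //; rewrite /E odd_double doubleK.
  have : (~` G) x by [].
  rewrite GC => -[n _ Cn]; exists n.*2.+1 => //.
  by rewrite /E /= odd_double /= uphalf_double.
exists O; split=> //.
have OE' : O `&` A `<=` E n by move=> x [Ox Ax]; apply: OE; split=> //; exact: subset_closure.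
move: OE'; rewrite /E; case: (odd n) => OE'; [left|right].
  by rewrite GC => x /OE' ?; exists n./2.
by rewrite HD => x /OE' ?; exists n./2.
Qed.

End HereditarilyBaire.

(** * Scattered continuity and weak discontinuity *)

Section Scattered.
Context {X Y : topologicalType}.
Implicit Types (f : X -> Y) (A S T : set X).

Lemma scattered_weakly_discontinuous f : regular_space Y ->
  scatteredly_continuous f -> weakly_discontinuous f.
Proof.
move=> rY /scatteredP sc; apply/weakly_discontinuousP => A V oV [v [Vv Av]].
pose D := [set a | [/\ V a, A a & ~ cts_at A f a]].
apply: contrapT => h.
have dD O : open O -> O `&` V `&` A !=set0 -> O `&` D !=set0.
  move=> oO OVA0; apply: contrapT => OD0; apply: h.
  exists (O `&` V); split=> //; first exact: openI.
  move=> a [[Oa Va] Aa]; apply: contrapT => nc; apply: OD0.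
  by exists a.
have [|x [Vx Ax ncx] cx] := sc D.
  have [|d [_ Dd]] := dD setT openT; last by exists d.
  by exists v.
apply: ncx => U oU Ux; apply: contrapT => nO.
have [W [oW Wx WU]] := regular_shrink rY oU Ux.
have [O [oO Ox OW]] := cx W oW Wx.
have [a [Oa Va Aa nUa]] : exists a, [/\ O a, V a, A a & ~ U (f a)].
  apply: contrapT => na; apply: nO; exists (O `&` V); split=> //.
    exact: openI.
  by move=> z [Oz Vz] Az; apply: contrapT => nUz; apply: na; exists z.
(* Otherwise [a] would lie in [D], which forces [f a] into [W] and hence into [U]. *)
have ca : cts_at A f a.
  apply: contrapT => nca; apply/nUa/WU/subset_closure/OW => //.
(* Near [a] the values of [f] on [A] avoid [closure W], yet [D] has points near [a], with values in
   [W]. *)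
have [||O' [oO' O'a O'W]] := ca (~` closure W).
- exact: closed_openC (@closed_closure _ W).
- by move=> /WU.
have [||d [[Od O'd] Dd]] := dD (O `&` O').
- exact: openI.
- by exists a.
have [Vd Ad _] := Dd.
exact: (O'W d O'd Ad (subset_closure (OW d Od Dd))).
Qed.

End Scattered.

(** * Closed pieces and piecewise continuity *)

Section Piecewise.
Context {X Y : topologicalType} (f : X -> Y).
Implicit Types (A S T C : set X).

Definition closed_piece C := closed C /\ forall a, C a -> cts_at C f a.

(** The pieces are closed in [X] and may leave [S], so the property passes to subsets. *)
Definition piecewise_on S :=
  exists2 C : nat -> set X, (forall n, closed_piece (C n)) & S `<=` \bigcup_n C n.

Lemma closed_piece0 : closed_piece set0.
Proof. by split; [exact: closed0|move=> a []]. Qed.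

Lemma closed_pieceI C A : closed A -> closed_piece C -> closed_piece (A `&` C).
Proof.
move=> cA [cC fC]; split; first exact: closedI.
by move=> a [Aa Ca]; apply: cts_at_sub (fC a Ca) => z [].
Qed.

Lemma piecewise_on_sub S T : S `<=` T -> piecewise_on T -> piecewise_on S.
Proof. by move=> ST [C pC TC]; exists C => //; exact: subset_trans TC. Qed.

Lemma piecewise_on_countable (I : countType) (C : I -> set X) S :
  (forall i, closed_piece (C i)) -> S `<=` \bigcup_i C i -> piecewise_on S.
Proof.
move=> pC SC; exists (fun n => if unpickle n is Some i then C i else set0).
  by move=> n; case: unpickle => [i|]; [exact: pC|exact: closed_piece0].
by move=> x /SC[i _ Ci]; exists (pickle i) => //; rewrite pickleK.
Qed.

Lemma piecewise_on_bigcup (S : nat -> set X) :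
  (forall n, piecewise_on (S n)) -> piecewise_on (\bigcup_n S n).
Proof.
move=> pS.
have /choice[C pC] n : exists C : nat -> set X,
    (forall m, closed_piece (C m)) /\ S n `<=` \bigcup_m C m.
  by have [C pC SC] := pS n; exists C.
apply: (@piecewise_on_countable (nat * nat)%type (fun p => C p.1 p.2)).
  by move=> p; exact: (pC p.1).1.
by move=> x [n _ Sx]; have [m _ Cx] := (pC n).2 x Sx; exists (n, m).
Qed.

Lemma piecewise_onU S T : piecewise_on S -> piecewise_on T ->
  piecewise_on (S `|` T).
Proof.
move=> pS pT; apply: (@piecewise_on_sub _ (\bigcup_n if n is 0%N then S else T)).
  by move=> x [Sx|Tx]; [exists 0%N|exists 1%N].
by apply: piecewise_on_bigcup => -[].
Qed.

Lemma piecewise_onP : piecewise_continuous f <-> piecewise_on setT.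
Proof.
split=> [[D [/countable_injP[g gD] Dc Df]]|[C pC CT]].
  exists (fun n => [set x | exists F, [/\ D F, g F = n & F x]]).
    move=> n; have [[F [DF gF]]|nF] := pselect (exists F, D F /\ g F = n).
      suff -> : [set x | exists F, [/\ D F, g F = n & F x]] = F.
        by have [cF /continuous_withinP fF] := Df F DF; split.
      apply/seteqP; split=> [x /= [F' [DF' gF' F'x]]|x Fx]; last by exists F.
      by rewrite (gD F F') ?inE// gF gF'.
    rewrite (_ : [set x | _] = set0); first exact: closed_piece0.
    by rewrite -subset0 => x [F [DF gF _]]; apply: nF; exists F.
  move=> x _; have : cover D id x by rewrite Dc.
  by case=> F DF Fx; exists (g F) => //; exists F.
exists (range C); split.
- exact: card_image_le.
- rewrite -subTset => x /CT[n _ Cn].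
  by exists (C n).
- by move=> _ [n _ <-]; have [cC fC] := pC n; split=> //; exact/continuous_withinP.
Qed.

Lemma piecewise_scattered : hereditarily_baire X ->
  piecewise_on setT -> scatteredly_continuous f.
Proof.
move=> bX [C pC CT]; apply/scatteredP => A A0.
have [|n [O [oO [a [Oa Aa]] OC]]] := @baire_closed_cover _ bX A C A0 (fun n => (pC n).1).
  exact: subset_trans CT.
have Ca : C n a by apply: OC; split=> //; exact: subset_closure.
exists a => //; apply: cts_at_open oO Oa _ ((pC n).2 a Ca) => z [Oz Az].
by apply: OC; split=> //; exact: subset_closure.
Qed.

(** The part of a closed piece that [f] sends outside an open set is closed, so preimages of closed
    sets are F_sigma. *)
Lemma piecewise_Gdelta : piecewise_on setT -> Gdelta_measurable_map f.
Proof.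
move=> [C pC CT] U oU.
rewrite (_ : f @^-1` U = ~` \bigcup_n (C n `&` f @^-1` (~` U))); last first.
  apply/seteqP; split=> [x Ux [n _ [_ nUx]]//|x nx].
  have [n _ Cn] := CT x I; apply: contrapT => nU; apply: nx.
  by exists n.
apply: setC_Gdelta => n; have [cC fC] := pC n.
move=> x cx; have Cx : C n x by apply: cC; apply: closure_subset cx => z [].
split=> // Ux; have [O [oO Ox OU]] := fC x Cx U oU Ux.
have [z [[Cz nUz] Oz]] := cx O (open_nbhs_nbhs (conj oO Ox)).
exact/nUz/OU.
Qed.

Lemma Gdelta_weakly_Gdelta : regular_space Y ->
  Gdelta_measurable_map f -> weakly_Gdelta_measurable f.
Proof.
move=> rY Gf; exists open; split=> //; last first.
  by move=> D _ Do; exact: bigcup_open.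
split.
  split=> // y U; rewrite nbhsE => -[V [oV Vy] VU].
  by exists V.
move=> U y oU Uy; have [V [oV Vy VU]] := regular_shrink rY oU Uy.
exists V, (~` closure V); split=> //.
- exact: closed_openC (@closed_closure _ V).
- by rewrite setCK; exact: subset_closure.
- by rewrite setCK.
Qed.

Lemma stable_piecewise : hausdorff_space Y -> stable_first_Baire f ->
  piecewise_on setT.
Proof.
move=> hY [g [cg gf]].
(* The points where the sequence is constant from [n] on form a closed set, as [Y] is Hausdorff, and
   [f] agrees with [g n] there. *)
exists (fun n => [set x | forall m, (n <= m)%N -> g m x = g n x]).
  move=> n; split.
    move=> x cx m nm; apply: hY => A B nA nB.
    have [z [/= gz [Az Bz]]] := cx (g m @^-1` A `&` g n @^-1` B)
      (@filterI _ (nbhs x) _ _ _ (cg m x _ nA) (cg n x _ nB)).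
    by exists (g m z); split=> //; rewrite gz.
  move=> a ga U oU.
  have fE z : (forall m, (n <= m)%N -> g m z = g n z) -> f z = g n z.
    move=> gz; have [k gk] := gf z.
    by rewrite -(gk (maxn n k)) ?leq_maxr// gz ?leq_maxl.
  rewrite fE// => Ua; exists (g n @^-1` U); split=> //.
    by apply: open_comp => // x _; exact: cg.
  by move=> z gz Cz; rewrite fE.
move=> x _; have [n gn] := gf x; exists n => // m nm.
by rewrite !gn.
Qed.

End Piecewise.

(** * Paracompactness *)

Section LocallyFinite.
Context {X : topologicalType}.
Implicit Types (x : X) (V : set (set X)).

Lemma nbhs_finite (I : choiceType) (D : set I) (P : I -> set X) x :
  finite_set D -> (forall i, D i -> nbhs x (P i)) ->
  nbhs x (\bigcap_(i in D) P i).
Proof.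
move=> fD nP; have cD : closed (\bigcup_(i in D) ~` (P i)°).
  by apply: closed_bigcup => // i _; exact: open_closedC (@open_interior _ _).
have : nbhs x (~` \bigcup_(i in D) ~` (P i)°).
  apply: open_nbhs_nbhs; split; first exact: closed_openC.
  by move=> [i Di]; apply; exact: nP.
apply: filterS => z nz i Di; apply: interior_subset; apply: contrapT => nPz.
by apply: nz; exists i.
Qed.

(** An open set that meets [closure A] meets [A], so only finitely many [H A] come near [x] and
    finitely many neighborhoods are intersected. With [P] empty this yields closedness of locally
    finite unions, with [P] a preimage continuity on them. *)
Lemma locally_finite_nbhs V (H P : set X -> set X) x : locally_finite V ->
  (forall A, V A -> H A `<=` closure A) ->
  (forall A, V A -> nbhs x [set z | H A z -> P A z]) ->
  nbhs x [set z | forall A, V A -> H A z -> P A z].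
Proof.
move=> lV HA nP; have [N nN fN] := lV x.
have nF := nbhs_finite fN (fun A DA => nP A DA.1).
apply: filterS2 nF (nbhs_interior nN) => z Fz Nz A VA Hz.
by apply: Fz => //; split=> //; exact: (HA A VA z Hz).
Qed.

Lemma locally_finite_closed V (H : set X -> set X) : locally_finite V ->
  (forall A, V A -> H A `<=` closure A /\ closed (H A)) ->
  closed (\bigcup_(A in V) H A).
Proof.
move=> lV cH x cx; apply: contrapT => nx.
have [|z [[A VA Hz] nz]] := cx [set z | forall A, V A -> H A z -> False].
  apply: (locally_finite_nbhs (P := fun=> set0) lV) => A VA; first exact: (cH A VA).1.
  apply: open_nbhs_nbhs; split; first exact: closed_openC (cH A VA).2.
  by move=> Hx; apply: nx; exists A.
exact: nz Hz.
Qed.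

Lemma closed_piece_locally_finite (Y : topologicalType) (f : X -> Y) V
    (H : set X -> set X) : locally_finite V ->
  (forall A, V A -> H A `<=` closure A /\ closed_piece f (H A)) ->
  closed_piece f (\bigcup_(A in V) H A).
Proof.
move=> lV cH; split.
  apply: locally_finite_closed => // A VA; have [HA [cA _]] := cH A VA.
  by split.
move=> x _ U oU Ux.
have : nbhs x [set z | forall A, V A -> H A z -> U (f z)].
  apply: (locally_finite_nbhs (P := fun=> f @^-1` U) lV) => A VA.
    exact: (cH A VA).1.
  have [_ [cA fA]] := cH A VA; have [Hx|nHx] := pselect (H A x).
    exact: cts_at_nbhs (fA x Hx) (open_nbhs_nbhs (conj oU Ux)).
  apply: filterS (open_nbhs_nbhs (conj (closed_openC cA) nHx)).
  by move=> z nHz /nHz.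
rewrite nbhsE => -[O [oO Ox] OU]; exists O; split=> // z Oz [A VA Az].
exact: OU Az.
Qed.

End LocallyFinite.

(** The complement of [K] completes the cover; refining members that meet [K] cannot lie in that
    complement, so they refine [U]. *)
Lemma paracompact_refine (X : topologicalType) (K : set X) (U : set (set X)) :
  paracompact X -> closed K -> U `<=` open -> K `<=` cover U id ->
  exists V : set (set X), [/\ V `<=` open, locally_finite V, K `<=` cover V id
    & forall A, V A -> exists2 B, U B & A `<=` B].
Proof.
move=> [_ pX] cK oU KU.
have [|V [[oV Vc] lV VU]] := pX (U `|` [set ~` K]).
  split; first by move=> A [/oU//|->]; exact: closed_openC.
  rewrite -subTset => x _; have [/KU[B UB Bx]|nKx] := pselect (K x).
    by exists B => //; left.
  by exists (~` K) => //; right.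
exists [set A | V A /\ A `&` K !=set0]; split.
- by move=> A [/oV].
- move=> x; have [N nN fN] := lV x; exists N => //.
  by apply: sub_finite_set fN => A /= [[VA _] AN].
- move=> x Kx; have : cover V id x by rewrite Vc.
  by case=> A VA Ax; exists A => //; split=> //; exists x.
- move=> A [VA [x [Ax Kx]]]; have [B [UB|->] AB] := VU A VA; first by exists B.
  by have := AB x Ax.
Qed.

(* With [S] a point this gives regularity, and then, with [S] closed, normality. *)
Lemma paracompact_separate (X : topologicalType) (K S : set X) :
  paracompact X -> closed K ->
  (forall x, K x -> exists U, [/\ open U, U x & closure U `&` S = set0]) ->
  exists U, [/\ open U, K `<=` U & closure U `&` S = set0].
Proof.
move=> pX cK sep.
have [||V [oV lV KV VU]] :=
  @paracompact_refine X K [set U | open U /\ closure U `&` S = set0] pX cK.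
- by move=> U [].
- by move=> x /sep[U [oU Ux US]]; exists U.
exists (\bigcup_(A in V) A); split=> //; first exact: bigcup_open.
have cV : closed (\bigcup_(A in V) closure A).
  apply: (locally_finite_closed lV) => A VA; split=> //.
  exact: closed_closure.
rewrite -subset0 => x [cx Sx].
have [|A VA Ax] := cV x.
  by apply: closure_subset cx => z [A VA Az]; exists A => //; exact: subset_closure.
have [B [_ BS0] AB] := VU A VA.
by rewrite -BS0; split=> //; exact: closure_subset Ax.
Qed.

Lemma paracompact_normal (X : topologicalType) (K L : set X) :
  paracompact X -> closed K -> closed L -> K `&` L = set0 ->
  exists U, [/\ open U, K `<=` U & closure U `&` L = set0].
Proof.
move=> pX cK cL KL; apply: paracompact_separate => // x Kx.
(* First [L] is separated from the point [x] by the Hausdorff property; the complement of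
   [closure U] is then a neighborhood of [x] whose closure misses [L]. *)
have [|U [oU LU Ux]] := @paracompact_separate X L [set x] pX cL.
  move=> y Ly; have yx : y != x.
    by apply/eqP => yx; have : set0 x by rewrite -KL; split=> //; rewrite -yx.
  have := pX.1; rewrite open_hausdorff => /(_ _ _ yx)[[A B] /=].
  move=> -[/set_mem Ay /set_mem Bx] [oA oB /eqP AB]; exists A; split=> //.
  rewrite -subset0 => z [+ /= zx]; rewrite {}zx => cx.
  have [w ABw] := cx B (open_nbhs_nbhs (conj oB Bx)).
  by rewrite AB in ABw.
exists (~` closure U); split.
- exact: closed_openC (@closed_closure _ U).
- by move=> cx; have : set0 x by rewrite -Ux.
- rewrite -subset0 => y [cy Ly].
  have [z [nz Uz]] := cy U (open_nbhs_nbhs (conj oU (LU y Ly))).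
  exact/nz/subset_closure.
Qed.

(** * From weak discontinuity to a countable closed cover *)

Section WeaklyDiscontinuous.
Context {X Y : topologicalType} (f : X -> Y).
Hypothesis pX : perfectly_paracompact X.
Implicit Types (A K W : set X).

Lemma open_Fsigma W : open W ->
  exists2 C : nat -> set X, (forall n, closed (C n)) & W = \bigcup_n C n.
Proof.
move=> oW; have [C cC WC] := Gdelta_setC (pX.2 _ (open_closedC oW)).
by exists C => //; rewrite -WC setCK.
Qed.

(** The union is F_sigma, and each closed layer [K n] has a locally finite open refinement [V].
    Every member of [V] splits into pieces indexed by pairs; gluing those of equal index over all of
    [V] leaves countably many pieces. *)
Lemma piecewise_on_cover (U : set (set X)) :
  (forall A, U A -> open A /\ piecewise_on f A) ->
  piecewise_on f (cover U id).
Proof.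
move=> oU.
have oW : open (cover U id) by apply: bigcup_open => A /oU[].
have [K cK WK] := open_Fsigma oW; rewrite WK.
apply: piecewise_on_bigcup => n.
have [||V [oV lV KV VU]] := @paracompact_refine X (K n) U pX.1 (cK n).
- by move=> A /oU[].
- by rewrite WK => x Kx; exists n.
have /choice[F FP] A : exists F : nat * nat -> set X, V A ->
    (forall p, F p `<=` A /\ closed_piece f (F p)) /\ A `<=` \bigcup_p F p.
  have [VA|nVA] := pselect (V A); last by exists (fun=> set0).
  have [B UB AB] := VU A VA; have [C pC AC] := piecewise_on_sub AB (oU B UB).2.
  have [D cD AD] := open_Fsigma (oV A VA).
  exists (fun p => D p.1 `&` C p.2) => _; split.
    move=> p; split; first by move=> x [Dx _]; rewrite AD; exists p.1.
    exact: closed_pieceI.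
  move=> x Ax; have [j _ Cx] := AC x Ax; have := Ax.
  by rewrite AD => -[i _ Dx]; exists (i, j).
apply: (@piecewise_on_countable _ _ _ (nat * nat)%type
          (fun p => \bigcup_(A in V) F A p)).
  move=> p; apply: (closed_piece_locally_finite lV) => A VA.
  have [/(_ p)[FA pF] _] := FP A VA; split=> //.
  exact: subset_trans FA (@subset_closure _ A).
move=> x /KV[A VA Ax]; have [p _ Fx] := (FP A VA).2 x Ax.
by exists p => //; exists A.
Qed.

Lemma weakly_discontinuous_piecewise :
  weakly_discontinuous f -> piecewise_on f setT.
Proof.
move=> /weakly_discontinuousP wd.
pose U := [set A | open A /\ piecewise_on f A].
have pW := @piecewise_on_cover U (fun A UA => UA).
suff -> : setT = cover U id by [].
apply/esym; rewrite -subTset => x0 _; apply: contrapT => nx0.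
have oW : open (cover U id) by apply: bigcup_open => A -[].
(* On the part of [O] outside the union [f] is continuous, so [O] itself belongs to [U], although it
   leaves the union. *)
have [|O [oO _ [x [Ox nWx]] fO]] := wd (~` cover U id) setT openT.
  by exists x0.
apply: nWx; exists O => //; split=> //.
apply: (@piecewise_on_sub _ _ _ _ (O `&` ~` cover U id `|` cover U id)).
  by move=> z Oz; have [Wz|nWz] := pselect (cover U id z); [right|left].
apply: piecewise_onU => //.
have [K cK OK] := open_Fsigma oO.
exists (fun n => K n `&` ~` cover U id).
  move=> n; split; first exact: closedI (cK n) (open_closedC oW).
  move=> z [Kz nWz]; have Oz : O z by rewrite OK; exists n.
  by apply: cts_at_sub (fO z (conj Oz nWz)) => w [].
by move=> z [Oz nWz]; have := Oz; rewrite OK => -[n _ Kz]; exists n.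
Qed.

End WeaklyDiscontinuous.

(** * Stable first Baire class *)

Lemma continuous_paste (X Y : topologicalType) (A B : set X) (g h k : X -> Y) :
  closed A -> closed B -> A `|` B = setT -> continuous g -> continuous h ->
  {in A, k =1 g} -> {in B, k =1 h} -> continuous k.
Proof.
move=> cA cB AB /continuous_cts_at cg /continuous_cts_at ch kg kh.
apply/continuous_subspace_setT; rewrite -AB; apply: withinU_continuous => //.
  apply/continuous_withinP => a Aa U oU.
  rewrite kg ?inE// => Ua; have [O [oO Oa OU]] := cg a U oU Ua.
  by exists O; split=> // z Oz Az; rewrite kg ?inE//; exact: OU.
apply/continuous_withinP => a Ba U oU.
rewrite kh ?inE// => Ua; have [O [oO Oa OU]] := ch a U oU Ua.
by exists O; split=> // z Oz Bz; rewrite kh ?inE//; exact: OU.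
Qed.

Lemma paracompact_normal_space (R : realType) (X : topologicalType) :
  paracompact X -> normal_space X.
Proof.
move=> pX; apply/(normal_openP (R := R)) => K L cK cL KL.
have [U [oU KU UL]] := paracompact_normal pX cK cL KL.
exists U, (~` closure U); split=> //.
- exact: closed_openC (@closed_closure _ U).
- by move=> x Lx cx; have : set0 x by rewrite -UL.
- by rewrite -subset0 => x [Ux]; apply; exact: subset_closure.
Qed.

Section StableFirstBaire.
Context {R : realType} {X Y : topologicalType} (f : X -> Y).
Hypotheses (pX : perfectly_paracompact X) (pY : path_connected R Y).
Implicit Types (E O : set X).

(* The freedom in [y] and [O] is what allows disjoint pieces to be glued. *)
Definition locally_extendable E := forall (y : Y) O, open O -> E `<=` O ->
  exists G : X -> Y, [/\ continuous G, {in E, G =1 f} & {in ~` O, G =1 cst y}].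

(* [absolute_extensor_pair] gives an extension that is some constant [y'] off a
   neighborhood of [E]; a path from [y'] to [y] composed with an Urysohn function
   then moves it to [y]. *)
Lemma extendable_piece (B : set Y) E : absolute_extensor_pair X B ->
  closed_piece f E -> f @` E `<=` B -> locally_extendable E.
Proof.
move=> aeB [cE fE] EB y O oO EO.
have [[e Ee]|E0] := pselect (E !=set0); last first.
  exists (cst y); split=> //; first exact: cst_continuous.
  by move=> x; rewrite inE => Ex; case: E0; exists x.
have [|U [oU EU UO]] := paracompact_normal pX.1 cE (open_closedC oO).
  by rewrite -subset0 => x [Ex nOx]; exact: nOx (EO x Ex).
have cU := open_closedC oU.
(* On the disjoint closed sets [E] and the complement of [U], [h] is [f] and a constant, hence
   continuous on their union. *)
pose h x := if pselect (E x) then f x else f e.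
have Bh x : B (h x) by rewrite /h; case: pselect => ?; apply: EB; [exists x|exists e].
have hE z : E z -> h z = f z by rewrite /h; case: pselect.
have hU z : ~ E z -> h z = f e by rewrite /h; case: pselect.
have [|G cG Gh] := aeB (E `|` ~` U) (fun a => exist _ (h (set_val a)) (mem_set (Bh _)))
  (closedU cE cU).
  move=> a W [_ [[W' oW' <-] /= W'a] W'W].
  rewrite nbhs_simpl /=.
  have nW : nbhs (h (set_val a)) W'.
    by apply: open_nbhs_nbhs; split=> //; rewrite set_valE /= in W'a *.
  have [N [oN Na NW]] : exists N, [/\ open N, N (set_val a)
      & forall z, N z -> (E `|` ~` U) z -> W' (h z)].
    have [Ea|nEa] := pselect (E (set_val a)).
      have [N [oN Na NW]] := fE _ Ea W' oW' (ltac:(by rewrite -hE//)).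
      exists (N `&` U); split; [exact: openI|by split=> //; exact: EU|].
      by move=> z [Nz Uz] [Ez|//]; rewrite hE//; exact: NW.
    exists (~` E); split=> //; first exact: closed_openC.
    by move=> z nEz _; rewrite hU// -(hU _ nEa).
  exists (set_val @^-1` N); split=> //=; first by exists N.
  move=> z /= Nz; apply: W'W => /=; rewrite set_valE /=; apply: NW => //.
  exact: set_valP.
have [l [cl l01 l0 l1]] : exists l : X -> R, [/\ continuous l,
    range l `<=` `[0%R, 1%R],
    [set l x | x in closure U] `<=` [set 0%R]
     & [set l x | x in ~` O] `<=` [set 1%R]].
  apply/uniform_separatorP; apply: (normal_separatorP (R := R)).1 UO.
  - exact: (@paracompact_normal_space R) pX.1.
  - exact: closed_closure.
  - exact: open_closedC.
have [gam [cgam gam0 gam1]] := pY (f e) y.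
have cgl : continuous (gam \o l).
  move: cgam => /continuous_withinP cgam.
  apply/continuous_cts_at => x W oW Wx.
  have [|N [oN Nx NW]] := cgam (l x) _ W oW Wx; first by apply: l01; exists x.
  exists (l @^-1` N); split=> //; first by apply: open_comp => // z _; exact: cl.
  by move=> z Nz _; apply: NW => //; apply: l01; exists z.
have GE x : E x -> G x = f x.
  move=> Ex; have := Gh (exist _ x (mem_set (or_introl Ex : (E `|` ~` U) x))).
  by rewrite !set_valE /= hE.
have GU x : ~ U x -> G x = f e.
  move=> nUx; have := Gh (exist _ x (mem_set (or_intror nUx : (E `|` ~` U) x))).
  by rewrite !set_valE /= hU// => /EU.
pose H x := if pselect (U x) then G x else gam (l x).
(* On the boundary of [U] both definitions give [f e], since [l] vanishes there. *)
have HG x : closure U x -> H x = G x.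
  rewrite /H; case: pselect => // nUx cx; rewrite GU// -gam0; congr gam.
  by apply: (l0 (l x)); exists x.
exists H; split.
- apply: (continuous_paste (@closed_closure _ U) cU _ cG cgl).
  + rewrite -subTset => x _; have [Ux|nUx] := pselect (U x); [left|by right].
    exact: subset_closure.
  + by move=> x; rewrite inE => /HG.
  + by move=> x; rewrite inE /H; case: pselect.
- move=> x; rewrite inE => Ex; rewrite HG ?GE//.
  exact/subset_closure/EU.
- move=> x; rewrite inE /H => nOx; case: pselect => [Ux|nUx].
    have : set0 x by rewrite -UO; split=> //; exact: subset_closure.
    by [].
  by have -> : l x = 1%R by apply: (l1 (l x)); exists x.
Qed.

(** The two extensions are taken constant [y] off disjoint open sets [U] and [U']; on the boundary
    of [U] both equal [y], so they paste. *)
Lemma extendableU E E' : closed E -> closed E' -> E `&` E' = set0 ->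
  locally_extendable E -> locally_extendable E' -> locally_extendable (E `|` E').
Proof.
move=> cE cE' EE' extE extE' y O oO EO.
have [U [oU EU UE']] := paracompact_normal pX.1 cE cE' EE'.
pose U' := ~` closure U.
have oU' : open U' by exact: closed_openC (@closed_closure _ U).
have [|G [cG Gf Gy]] := extE y (O `&` U) (openI oO oU).
  by move=> x Ex; split; [apply: EO; left|exact: EU].
have [|G' [cG' G'f G'y]] := extE' y (O `&` U') (openI oO oU').
  move=> x Ex; split; [by apply: EO; right|move=> cx].
  by have : set0 x by rewrite -UE'.
pose H x := if pselect (U x) then G x else G' x.
have HG x : ~ U' x -> H x = G x.
  rewrite /H; case: pselect => // nU nU'x.
  by rewrite G'y ?Gy// inE => -[].
have HG' x : ~ U x -> H x = G' x by rewrite /H; case: pselect.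
have nE'U x : E' x -> ~ U x.
  by move=> E'x Ux; have : set0 x by rewrite -UE'; split=> //; exact: subset_closure.
exists H; split.
- apply: (continuous_paste (open_closedC oU') (open_closedC oU) _ cG cG').
  + rewrite -subTset => x _; have [Ux|nUx] := pselect (U x); [left|by right].
    by move=> /(_ (subset_closure Ux)).
  + by move=> x; rewrite inE => /HG.
  + by move=> x; rewrite inE => /HG'.
- move=> x; rewrite inE => -[Ex|E'x].
    by rewrite HG ?Gf ?inE// => /(_ (subset_closure (EU x Ex))).
  by rewrite HG' ?G'f ?inE//; exact: nE'U.
- move=> x; rewrite inE /H => nOx; case: pselect => Ux.
    by rewrite Gy// inE => -[].
  by rewrite G'y// inE => -[].
Qed.

Lemma extendable_bigU (E : nat -> set X) n :
  (forall i, closed (E i)) -> trivIset setT E ->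
  (forall i, locally_extendable (E i)) ->
  locally_extendable (\big[setU/set0]_(i < n) E i).
Proof.
move=> cE tE extE; elim: n => [|n IH].
  rewrite big_ord0 => y O oO _; exists (cst y); split=> //.
    exact: cst_continuous.
  by move=> x; rewrite inE.
rewrite big_ord_recr; apply: extendableU => //.
  by apply: closed_bigsetU.
rewrite -subset0 => x; rewrite -bigcup_mkord => -[[i /= ni Ei] En].
by have := tE i n I I (ex_intro _ x (conj Ei En)) => ie; rewrite ie ltnn in ni.
Qed.

(** Each piece [D n] is mapped into one set of the cover of [Y]. Removing the earlier pieces leaves
    disjoint F_sigma sets; [E m n] is the closed approximation of the [n]-th one at stage [m],
    increasing with [m]. *)
Lemma piecewise_stable : sigma_absolute_extensor X Y ->
  piecewise_on f setT -> stable_first_Baire f.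
Proof.
move=> [Z [ZT aeZ]] [C0 pC0 C0T].
(* A point of [X] supplies the constant [f x0] used in the extensions below. *)
have [[x0 _]|X0] := pselect ([set: X] !=set0); last first.
  exists (fun=> f); split; last by move=> x; exists 0%N.
  by move=> _ x; case: X0; exists x.
pose D0 (p : nat * nat) := C0 p.1 `&` f @^-1` Z p.2.
have pD0 p : closed_piece f (D0 p).
  have [cC fC] := pC0 p.1; rewrite /D0; split; last first.
    by move=> a [Ca _]; apply: cts_at_sub (fC a Ca) => z [].
  move=> x cx; have Cx : C0 p.1 x by apply: cC; apply: closure_subset cx => z [].
  split=> //; have [cZ _ _] := aeZ p.2; apply: cZ => W.
  move=> /(cts_at_nbhs (fC x Cx)) nW; have [z [[Cz Zz] Wz]] := cx _ nW.
  by exists (f z); split=> //; exact: Wz.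
pose D n := if unpickle n is Some p then D0 p else set0.
have pD n : closed_piece f (D n).
  by rewrite /D; case: unpickle => [p|]; [exact: pD0|exact: closed_piece0].
have DT x : exists n, D n x.
  have [n _ Cn] := C0T x I; have : [set: Y] (f x) by [].
  by rewrite -ZT => -[m _ Zm]; exists (pickle (n, m)); rewrite /D pickleK.
have oD n : open (~` \big[setU/set0]_(i < n) D i).
  by apply: closed_openC; apply: closed_bigsetU => i _; exact: (pD i).1.
have /choice[K KP] n : exists K : nat -> set X,
    (forall j, closed (K j)) /\ ~` (\big[setU/set0]_(i < n) D i) = \bigcup_j K j.
  by have [K cK KE] := open_Fsigma pX (oD n); exists K.
pose E m n := (\big[setU/set0]_(j < m) K n j) `&` D n.
have cE m n : closed (E m n).
  apply: closedI (pD n).1; apply: closed_bigsetU => j _; exact: (KP n).1.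
have extE m n : locally_extendable (E m n).
  have pE : closed_piece f (E m n).
    apply: closed_pieceI => //; apply: closed_bigsetU => j _; exact: (KP n).1.
  move: pE; rewrite /E /D; case: unpickle => [p|] pE.
    have [_ _ aeB] := aeZ p.2; apply: extendable_piece aeB pE _.
    by move=> _ [x [_ [_ Zx]] <-].
  have [_ _ aeB] := aeZ 0%N; apply: extendable_piece aeB pE _.
  by move=> _ [x [_ []]].
have tE m : trivIset setT (E m).
  have dE i j x : (i < j)%N -> E m i x -> E m j x -> False.
    move=> ij [_ Dx] [Kx _]; have : (\bigcup_k K j k) x.
      by move: Kx; rewrite -bigcup_mkord => -[k _ Kk]; exists k.
    by rewrite -(KP j).2; apply; rewrite -bigcup_mkord; exists i.
  move=> i j _ _ [x [Ei Ej]]; case: (ltngtP i j) => // ij; exfalso.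
    exact: dE ij Ei Ej.
  exact: dE ij Ej Ei.
have /choice[g gP] m := @extendable_bigU _ m (cE m) (tE m) (extE m)
  (f x0) setT openT (@subsetT _ _).
exists g; split=> [m|x]; first by have [] := gP m.
have [n Dx nD] : exists2 n, D n x & ~ (\big[setU/set0]_(i < n) D i) x.
  have exD : exists n, `[< D n x >] by have [n Dn] := DT x; exists n; exact/asboolP.
  case: (ex_minnP exD) => n /asboolP Dn nmin; exists n => //.
  rewrite -bigcup_mkord => -[i /= ni Di]; have /nmin : `[< D i x >] by exact/asboolP.
  by rewrite leqNgt ni.
have : (~` \big[setU/set0]_(i < n) D i) x by [].
rewrite (KP n).2 => -[j _ Kj].
(* Past [n] the [n]-th set takes part in stage [m]; past [j] its approximation contains [K n j]. *)
exists (maxn n j).+1 => m; rewrite gtn_max => /andP[nm jm].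
have [_ gf _] := gP m; apply: gf; rewrite inE -bigcup_mkord; exists n => //.
by split=> //; rewrite -bigcup_mkord; exists j.
Qed.

End StableFirstBaire.

(** * Weakly G_delta-measurable maps *)

(** The exponents of 2 and 3 in [n] encode a sequence to follow and a colour; the factor [5 ^ N]
    makes [n] large. *)
Lemma nat_schedule (i b N : nat) :
  exists n, [/\ (N <= n)%N, (i < n)%N, logn 2 n = i & logn 3 n = b].
Proof.
have p2 : (0 < 2 ^ i)%N by rewrite expn_gt0.
have p3 : (0 < 3 ^ b)%N by rewrite expn_gt0.
have p5 : (0 < 5 ^ N)%N by rewrite expn_gt0.
exists (2 ^ i * 3 ^ b * 5 ^ N)%N; split.
- apply: leq_trans (leq_pmull _ _); first exact: ltnW (ltn_expl _ _).
  by rewrite muln_gt0 p2.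
- rewrite -mulnA; apply: leq_trans (leq_pmulr _ _); first exact: ltn_expl.
  by rewrite muln_gt0 p3.
- by rewrite !lognM ?muln_gt0 ?p2 ?p3// !lognX !logn_prime//= !muln0 muln1 !addn0.
- by rewrite !lognM ?muln_gt0 ?p2 ?p3// !lognX !logn_prime//= !muln0 muln1 addn0.
Qed.

Section WeaklyGdelta.
Context {X Y : topologicalType} (f : X -> Y).
Hypotheses (bX : hereditarily_baire X) (psX : preiss_simon X).
Variable B : set (set Y).
Hypotheses (rB : regular_base B) (aB : countably_additive B).
Hypothesis GB : forall U, B U -> Gdelta (f @^-1` U).
Implicit Types (A S T O : set X) (U V W : set Y) (F : nat -> set X).

Definition scattered_on T :=
  forall A, A `<=` T -> A !=set0 -> exists2 a, A a & cts_at A f a.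

Definition nowhere_cts A := forall a, A a -> ~ cts_at A f a.

Lemma scattered_on_sub S T : S `<=` T -> scattered_on T -> scattered_on S.
Proof. by move=> ST sT A AS; apply: sT; exact: subset_trans ST. Qed.

Lemma nowhere_ctsI A O : open O -> nowhere_cts A -> nowhere_cts (O `&` A).
Proof.
move=> oO nA a [Oa Aa] ca; apply: (nA a Aa).
exact: cts_at_open oO Oa _ ca.
Qed.

Lemma nowhere_cts_unscattered A T : A !=set0 -> A `<=` T -> nowhere_cts A ->
  ~ scattered_on T.
Proof. by move=> A0 AT nA sT; have [a Aa] := sT A AT A0; exact: nA. Qed.

Lemma unscattered T : ~ scattered_on T ->
  exists A, [/\ A !=set0, A `<=` T & nowhere_cts A].
Proof.
move=> nT; apply: contrapT => h; apply: nT => A AT A0; apply: contrapT => nA.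
by apply: h; exists A; split=> // a Aa ca; apply: nA; exists a.
Qed.

Lemma base_open U : B U -> open U.
Proof. by have [[Bo _] _] := rB; exact: Bo. Qed.

Lemma base_shrink U y : open U -> U y -> exists V W,
  [/\ B V, B W, V y, V `<=` ~` W & ~` W `<=` U].
Proof. by have [_] := rB; exact. Qed.

(** The preimages of [V] and [W] are disjoint G_delta sets, so a relatively open part of any
    nonempty subset of [T] misses one of them. *)
Lemma scattered_on_split T V W : B V -> B W -> V `&` W = set0 ->
  scattered_on (T `\` f @^-1` V) -> scattered_on (T `\` f @^-1` W) ->
  scattered_on T.
Proof.
move=> BV BW VW sV sW A AT A0.
have [|O [oO OA0 OA]] := disjoint_Gdelta bX (GB BV) (GB BW) _ A0.
  by rewrite -preimage_setI VW preimage_set0.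
suff [a [Oa Aa] ca] : exists2 a, (O `&` A) a & cts_at (O `&` A) f a.
  exists a => //; exact: cts_at_open oO Oa _ ca.
have OT : O `&` A `<=` T by move=> x [_ /AT].
by case: OA => OA; [apply: sV|apply: sW] => // x OAx;
  split; [exact: OT|exact: OA|exact: OT|exact: OA].
Qed.

(* If every point had a neighborhood [O] with [O `&` T `\` f @^-1` V] scattered for
   some [V] around its value, then two disjoint such [V], coming from a discontinuity,
   would make a neighborhood scattered by [scattered_on_split]. *)
Lemma irreducible_point T : ~ scattered_on T -> exists z V,
  [/\ T z, B V, V (f z)
    & forall O, open O -> O z -> ~ scattered_on (O `&` (T `\` f @^-1` V))].
Proof.
move=> /unscattered[A [[x Ax] AT nA]]; apply: contrapT => h.
have {}h z V : T z -> B V -> V (f z) ->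
    exists O, [/\ open O, O z & scattered_on (O `&` (T `\` f @^-1` V))].
  move=> Tz BV Vz; apply: contrapT => nO; apply: h; exists z, V; split=> // O oO Oz sO.
  by apply: nO; exists O.
apply: (nA x Ax) => U oU Ux; apply: contrapT => nU.
have [V [W [BV BW Vx VW WU]]] := base_shrink oU Ux.
have [O [oO Ox sO]] := h x V (AT x Ax) BV Vx.
have [a [Oa Aa nUa]] : exists a, [/\ O a, A a & ~ U (f a)].
  apply: contrapT => na; apply: nU; exists O; split=> // z Oz Az.
  by apply: contrapT => nUz; apply: na; exists z.
have Wa : W (f a) by apply: contrapT => nWa; exact/nUa/WU.
have [O' [oO' O'a sO']] := h a W (AT a Aa) BW Wa.
have nOA : nowhere_cts (O `&` O' `&` A) by apply: nowhere_ctsI => //; exact: openI.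
apply: (@nowhere_cts_unscattered _ (O `&` O' `&` T) _ _ nOA); first by exists a.
  by move=> z [OOz /AT].
apply: (scattered_on_split BV BW).
- by rewrite -subset0 => y [/VW].
- by apply: scattered_on_sub sO => z [[[Oz O'z] Tz] nVz].
- by apply: scattered_on_sub sO' => z [[[Oz O'z] Tz] nVz].
Qed.

Definition converges_to F (x : X) := forall N, nbhs x N -> \forall n \near \oo, F n `<=` N.

(** Badness is asked infinitely often, not eventually, so that one half of a splitting inherits
    it. *)
Definition persists F T := forall n, exists2 m, (n <= m)%N & ~ scattered_on (F m `&` T).

Lemma persists_sub F S T : S `<=` T -> persists F S -> persists F T.
Proof.
move=> ST pS n; have [m nm nS] := pS n; exists m => // sT; apply: nS.
by apply: scattered_on_sub sT; exact: setIS.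
Qed.

Lemma persists_split F T V W : B V -> B W -> V `&` W = set0 -> persists F T ->
  persists F (T `\` f @^-1` V) \/ persists F (T `\` f @^-1` W).
Proof.
move=> BV BW VW pT; apply: contrapT => /not_orP[nV nW].
have notP S : ~ persists F S ->
    exists n, forall m, (n <= m)%N -> scattered_on (F m `&` S).
  move=> nS; apply: contrapT => h; apply: nS => n; apply: contrapT => nm.
  apply: h; exists n => m le_nm; apply: contrapT => nS; apply: nm.
  by exists m.
have [n1 s1] := notP _ nV; have [n2 s2] := notP _ nW.
have [m] := pT (maxn n1 n2); rewrite geq_max => /andP[m1 m2]; apply.
by apply: (scattered_on_split BV BW VW); rewrite -setIDA;
  [exact: s1|exact: s2].
Qed.

(* The Preiss-Simon property is applied to the largest subset of [T] on which [f] is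
   nowhere continuous. *)
Lemma persistent_sequence T z :
  (forall O, open O -> O z -> ~ scattered_on (O `&` T)) ->
  exists2 F, converges_to F z & persists F T.
Proof.
move=> irr.
pose K := [set x | exists A, [/\ A `<=` T, nowhere_cts A & A x]].
have KT : K `<=` T by move=> x [A [AT _ Ax]]; exact: AT.
have nK : nowhere_cts K.
  move=> x [A [AT nA Ax]] cx; apply: (nA x Ax); apply: cts_at_sub cx => y Ay.
  by exists A.
have zK : closure K z.
  move=> N; rewrite nbhsE => -[O [oO Oz] ON].
  have [A [[a Aa] AO nA]] := unscattered (irr O oO Oz).
  exists a; split; last by apply: ON; case: (AO a Aa).
  by exists A; split=> // y /AO[].
have [F [FK Fz]] := psX zK; exists F => // n; exists n => //.
have [Fn0 [O oO FE]] := FK n.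
apply: (nowhere_cts_unscattered Fn0); first by rewrite FE => x [Ox Kx]; split=> //; exact: KT.
by rewrite FE; exact: nowhere_ctsI.
Qed.

(* Induction on [n]: if the candidate found for the first [n] sequences destroys
   [Fs n], then by [persists_split] a second candidate with disjoint [V] does not. *)
Lemma persistent_candidate n (Fs : nat -> nat -> set X) T S :
  (forall i, (i < n)%N -> persists (Fs i) T) -> S `<=` T -> ~ scattered_on S ->
  exists z V, [/\ S z, B V, V (f z),
    forall O, open O -> O z -> ~ scattered_on (O `&` (S `\` f @^-1` V))
    & forall i, (i < n)%N -> persists (Fs i) (T `\` f @^-1` V)].
Proof.
elim: n S => [|n IH] S pT ST nS.
  by have [z [V [Sz BV Vz irr]]] := irreducible_point nS; exists z, V.
have pT' i : (i < n)%N -> persists (Fs i) T by move=> /ltnW; exact: pT.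
have shr (V V' : set Y) A : V' `<=` V -> A `\` f @^-1` V `<=` A `\` f @^-1` V'.
  by move=> V'V x [Ax nVx]; split=> // /V'V.
have [z1 [V1 [Sz1 BV1 Vz1 irr1 p1]]] := IH S pT' ST nS.
have [V [W [BV BW Vz VW WV1]]] := base_shrink (base_open BV1) Vz1.
have VV1 := subset_trans VW WV1.
have [pV|npV] := pselect (persists (Fs n) (T `\` f @^-1` V)).
  exists z1, V; split=> //.
    move=> O oO Oz sO; apply: (irr1 O oO Oz); apply: scattered_on_sub sO.
    by apply: setIS; exact: shr.
  move=> i; rewrite ltnS leq_eqVlt => /predU1P[->//|/p1].
  by apply: persists_sub; exact: shr.
(* Points of [S] with values outside [V1] have values in [W], so this part of [S] is still bad. The
   second candidate is sought there, and its neighborhood is shrunk into [W], away from [V]. *)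
have nS' : ~ scattered_on (S `&` f @^-1` W).
  move=> sW; apply: (irr1 setT openT I); apply: scattered_on_sub sW => x [_ [Sx nVx]].
  by split=> //; apply: contrapT => nWx; exact/nVx/WV1.
have [|z2 [V2 [[Sz2 Wz2] BV2 Vz2 irr2 p2]]] := IH _ pT' _ nS'.
  by move=> x [/ST].
have [U [W' [BU _ Uz UW' W'V]]] :=
  base_shrink (openI (base_open BV2) (base_open BW)) (conj Vz2 Wz2).
have UV := subset_trans UW' W'V.
have UV2 : U `<=` V2 by move=> y /UV[].
exists z2, U; split=> //.
  move=> O oO Oz sO; apply: (irr2 O oO Oz); apply: scattered_on_sub sO.
  apply: setIS; apply: subset_trans (shr _ _ _ UV2); apply: setSD.
  exact: subIsetl.
move=> i; rewrite ltnS leq_eqVlt => /predU1P[->|/p2]; last first.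
  by apply: persists_sub; exact: shr.
have VU0 : V `&` U = set0 by rewrite -subset0 => y [/VW nWy /UV[]].
by have [] := persists_split BV BU VU0 (pT n (ltnSn n)).
Qed.

(** A state is the list of choices made so far with a closed set containing their neighborhoods; off
    its preimage [X] stays bad and all chosen sequences persist. The [n]-th point is taken in a late
    term of the sequence of index [logn 2 n]. *)
Lemma separated_sequence : ~ scattered_on setT ->
  exists (x : nat -> X) (V : nat -> set Y) (F : nat -> nat -> set X),
  [/\ forall n, [/\ B (V n), V n (f (x n)) & converges_to (F n) (x n)],
      forall i j, (i < j)%N -> V i `&` V j = set0
    & forall n, (logn 2 n < n)%N ->
        exists2 m, (n <= m)%N & F (logn 2 n) m (x n)].
Proof.
move=> nT.
have [x0 _] : [set: X] !=set0 by have [A [[a _] _ _]] := unscattered nT; exists a.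
pose state := (seq (X * set Y * (nat -> set X)) * set Y)%type.
pose d : X * set Y * (nat -> set X) := (x0, set0, fun=> set0).
pose inv (s : state) := [/\ closed s.2, ~ scattered_on (~` (f @^-1` s.2))
  & forall i, (i < size s.1)%N -> let e := nth d s.1 i in
    [/\ B e.1.2, e.1.2 (f e.1.1), e.1.2 `<=` s.2, converges_to e.2 e.1.1
      & persists e.2 (~` (f @^-1` s.2))]].
pose next (s s' : state) := exists e, [/\ s'.1 = rcons s.1 e,
  e.1.2 `&` s.2 = set0 & let n := size s.1 in (logn 2 n < n)%N ->
    exists2 m, (n <= m)%N & (nth d s.1 (logn 2 n)).2 m e.1.1].
have step (s : {s | inv s}) : {s' : {s' | inv s'} | next (sval s) (sval s')}.
  apply: cid; case: s => -[l C] [cC nC Il] /=.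
  rewrite /= in cC nC Il.
  set n := size l; set T := ~` (f @^-1` C).
  have [S [ST nS Sn]] : exists S, [/\ S `<=` T, ~ scattered_on S & (logn 2 n < n)%N ->
      exists2 m, (n <= m)%N & S `<=` (nth d l (logn 2 n)).2 m].
    case: (ltnP (logn 2 n) n) => [tn|_].
      have [_ _ _ _ /(_ n)[m nm nS]] := Il _ tn.
      exists ((nth d l (logn 2 n)).2 m `&` T); split=> //.
      by move=> _; exists m => // x [].
    by exists T; split.
  have [z [V [Sz BV Vz irr pV]]] := @persistent_candidate n
    (fun i => (nth d l i).2) T S (fun i ni => let: And5 _ _ _ _ p := Il i ni in p) ST nS.
  have oVC : open (V `&` ~` C) by apply: openI (base_open BV) (closed_openC cC).
  have [U [W [BU BW Uz UW WV]]] := base_shrink oVC (conj Vz (ST z Sz)).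
  (* The complement of [W] is a closed set between [U] and [V], so enlarging [C] by it removes no
     more than the preimage of [V]. *)
  pose C' := C `|` ~` W.
  have TC' : T `\` f @^-1` V `<=` ~` (f @^-1` C').
    by move=> x [Tx nVx] [/Tx//|/WV[/nVx]].
  have [|F Fz pF] := @persistent_sequence (~` (f @^-1` C')) z.
    move=> O oO Oz sO; apply: (irr O oO Oz); apply: scattered_on_sub sO.
    by apply: setIS; apply: subset_trans TC'; exact: setSD.
  have iC' : inv (rcons l (z, U, F), C').
    split=> /=.
    - exact: closedU cC (open_closedC (base_open BW)).
    - move=> sC'; apply: (irr setT openT I); apply: scattered_on_sub sC'.
      by apply: subset_trans TC' => x [_ [/ST]].
    - move=> i; rewrite size_rcons ltnS nth_rcons leq_eqVlt => /predU1P[->|il].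
        rewrite ltnn eqxx /=; split=> //.
        by apply: subset_trans UW _ => y; right.
      rewrite il; have [? ? VC ? _] := Il i il; split=> //.
        by apply: subset_trans VC _ => y; left.
      exact: persists_sub TC' (pV i il).
  exists (exist _ (rcons l (z, U, F), C') iC') => /=.
  exists (z, U, F); split=> //=.
    by rewrite -subset0 => y [/UW/WV[]].
  by move=> /Sn[m nm Sm]; exists m => //; exact: Sm.
have i0 : inv ([::], set0).
  split=> //=; first exact: closed0.
  by rewrite preimage_set0 setC0.
have [u [u0 un]] := dependent_choice step (exist _ _ i0).
pose l n := (sval (u n)).1.
pose e n := nth d (l n.+1) n.
have lE n : size (l n) = n /\ forall i, (i < n)%N -> nth d (l n) i = e i.
  elim: n => [|n [sn IH]]; first by rewrite /l u0.
  have [a [la _ _]] := un n; rewrite -/(l n.+1) -/(l n) in la.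
  split; first by rewrite la size_rcons sn.
  move=> i; rewrite ltnS leq_eqVlt => /predU1P[->//|ni].
  by rewrite la nth_rcons sn ni IH.
have eE n a : l n.+1 = rcons (l n) a -> e n = a.
  by rewrite /e => ->; rewrite nth_rcons (lE n).1 ltnn eqxx.
have Ie n i : (i < n)%N -> [/\ B (e i).1.2, (e i).1.2 (f (e i).1.1),
    (e i).1.2 `<=` (sval (u n)).2 & converges_to (e i).2 (e i).1.1].
  move=> ni; have [_ _ /(_ i)] := svalP (u n).
  by rewrite -/(l n) (lE n).1 (lE n).2// => /(_ ni)[].
exists (fun n => (e n).1.1), (fun n => (e n).1.2), (fun n => (e n).2); split.
- by move=> n; have [] := Ie n.+1 n (ltnSn n).
- move=> i j ij; have [a [la aC _]] := un j; rewrite (eE j a la).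
  have [_ _ VC _] := Ie j i ij; rewrite -subset0 => y [/VC Cy ay].
  by rewrite -aC.
- move=> n tn; have [a [la _]] := un n.
  by rewrite /= -/(l n) (lE n).1 (lE n).2// (eE n a la) => /(_ tn).
Qed.

Lemma weakly_Gdelta_scattered_on : scattered_on setT.
Proof.
apply: contrapT => /separated_sequence[x [V [F [xP dV tF]]]].
pose G b := \bigcup_(U in [set V n | n in [set n | logn 3 n = b]]) U.
have BG b : B (G b).
  apply: aB; first exact: card_le_trans (card_image_le _ _) (subset_card_le (@subsetT _ _)).
  by move=> _ [n _ <-]; have [] := xP n.
have GI : G 0%N `&` G 1%N = set0.
  rewrite -subset0 => y [[_ [i /= i0 <-] Vi] [_ [j /= j1 <-] Vj]].
  have [ij|ji|ij] := ltngtP i j; last by rewrite ij j1 in i0.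
    by have : set0 y by rewrite -(dV i j ij).
  by have : set0 y by rewrite -(dV j i ji).
have [||O [oO [y [Oy [i _ xi]]] OG]] :=
  disjoint_Gdelta bX (A := range x) (GB (BG 0%N)) (GB (BG 1%N)).
- by rewrite -preimage_setI GI preimage_set0.
- by exists (x 0%N); exists 0%N.
(* Infinitely many indices of colour [b] follow the sequence of [x i], whose terms end up inside
   [O]. *)
have hit b : exists2 z, (O `&` range x) z & G b (f z).
  have [_ _ /(_ O)] := xP i; rewrite xi.
  move=> /(_ (open_nbhs_nbhs (conj oO Oy)))[N _ NF].
  have [n [Nn lin t2 t3]] := nat_schedule i b N.
  have [|m nm Fx] := tF n; first by rewrite t2.
  rewrite t2 in Fx; exists (x n).
    split; last by exists n.
    exact: NF (leq_trans Nn nm) _ Fx.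
  by exists (V n); [exists n|have [] := xP n].
by case: OG => OG; [have [z /OG] := hit 0%N|have [z /OG] := hit 1%N].
Qed.

End WeaklyGdelta.

(** * The implications combined into equivalences *)

Theorem theorem8p1 (R : realType) (X Y : topologicalType) (f : X -> Y)
    (pX : perfectly_paracompact X) (bX : hereditarily_baire X)
    (rY : regular_T1_space Y) :
  [/\ (scatteredly_continuous f <-> weakly_discontinuous f)
        /\ (weakly_discontinuous f <-> piecewise_continuous f),
      preiss_simon X ->
        (scatteredly_continuous f <-> Gdelta_measurable_map f)
        /\ (scatteredly_continuous f <-> weakly_Gdelta_measurable f)
    & path_connected R Y -> sigma_absolute_extensor X Y ->
        (scatteredly_continuous f <-> stable_first_Baire f)].
Proof.
have hY : hausdorff_space Y.
  rewrite open_hausdorff => x y xy.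
  have oy : open (~` [set y]).
    exact: closed_openC (@accessible_closed_set1 _ rY.2 y).
  have [V [oV Vx Vy]] := regular_shrink rY.1 oy (fun e => negP xy (introT eqP e)).
  exists (V, ~` closure V) => /=.
    by rewrite !inE; split=> // /Vy; apply.
  split=> //; first exact: closed_openC (@closed_closure _ V).
  by apply/eqP; rewrite -subset0 => z [/subset_closure].
have sw : scatteredly_continuous f -> weakly_discontinuous f.
  exact: scattered_weakly_discontinuous rY.1.
have wp : weakly_discontinuous f -> piecewise_on f setT.
  exact: weakly_discontinuous_piecewise.
have ps : piecewise_on f setT -> scatteredly_continuous f.
  exact: piecewise_scattered.
split.
- split; first by split=> // /wp.
  by split=> [/wp/piecewise_onP//|/piecewise_onP/ps/sw].
- move=> psX.
  have sG : scatteredly_continuous f -> Gdelta_measurable_map f.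
    by move=> /sw/wp; exact: piecewise_Gdelta.
  have Gw : Gdelta_measurable_map f -> weakly_Gdelta_measurable f.
    exact: Gdelta_weakly_Gdelta rY.1.
  have ws : weakly_Gdelta_measurable f -> scatteredly_continuous f.
    move=> [B [rB aB GB]]; apply/scatteredP => A.
    exact: (weakly_Gdelta_scattered_on bX psX rB aB GB).
  split; first by split=> [/sG|/Gw/ws].
  by split=> [/sG/Gw|/ws].
- move=> pY aeY; split=> [/sw/wp|/(stable_piecewise hY)//].
  exact: piecewise_stable pX pY aeY.
Qed.
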